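(* Fix the online learning to rank game with top-1 feedback and any NDCG calibrated surrogate $\phi$. Then, for every learner's algorithm, there exists an adversary strategy such that the learner's expected regret is $\Omega(T)$.
   Context: The game is played over $T$ rounds against an oblivious adversary. At round $t$ the adversary generates a document matrix $X_t\in\mathbb{R}^{m\times d}$ (rows bounded in $\ell_2$ norm); the learner receives $X_t$, produces a (possibly random) score vector $\tilde s_t\in\mathbb{R}^m$ and ranks the documents by $\pi_{\tilde s_t}=\mathrm{argsort}(\tilde s_t)$, the permutation (from ranks to documents) sorting the scores in descending order. The adversary generates a relevance vector $R_t\in\{0,1,\dots,n\}^m$, and the learner observes only $R_t(\pi_{\tilde s_t}(1))$ (top-1 feedback). The learner suffers the loss $\phi(\tilde s_t,R_t)$, where $\phi:\mathbb{R}^m\times\{0,1,\dots,n\}^m\to\mathbb{R}$ is the surrogate. The expected regret is $\mathbb{E}\big[\sum_{t=1}^T\phi(\tilde s_t,R_t)\big]-\min_{\|w\|_2\le U}\sum_{t=1}^T\phi(X_tw,R_t)$, where $U$ bounds the norm of the ranking parameters $w\in\mathbb{R}^d$. NDCG calibration. Let $G(a)=2^a-1$, $G(\mathbf R)=(G(R(1)),\dots,G(R(m)))^\top$, and $Z(R)=\max_\sigma\sum_{i=1}^m\frac{2^{R(i)}-1}{\log_2(1+\sigma^{-1}(i))}$, the maximum being over permutations $\sigma$ of $\{1,\dots,m\}$, with $\sigma^{-1}(i)$ the rank of document $i$ (and $G(\mathbf R)/Z(R)$ read as $\mathbf 0$ for $R=\mathbf 0$). For a distribution $q$ on the relevance vectors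 let $\bar\phi(s,q)=\mathbb{E}_{R\sim q}\phi(s,R)$; it is assumed that $\bar\phi(\cdot,q)$ has a unique minimizer $s^*_\phi(q)$ for each $q$. The surrogate $\phi$ is NDCG calibrated if and only if for any distribution $q$ there exists an invertible, order preserving map $g:\mathbb{R}^m\to\mathbb{R}^m$ such that $s^*_\phi(q)=g\big(\mathbb{E}_{R\sim q}[G(\mathbf R)/Z(R)]\big)$.
   Formalization: Proved for U>0, d≥2, m≥2 documents, n≥1, excluding (m,n)=(2,1): at each excluded parameter some NDCG calibrated surrogate allows sublinear regret. The unnamed bound on document rows may depend on the surrogate and U; the surrogate and tie-breaking are assumed Borel. *)

(* Defs.v *)
From HB Require Import structures.
From mathcomp Require Import all_boot all_order all_algebra all_fingroup.
From mathcomp Require Import all_classical all_reals all_analysis.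

Set Implicit Arguments.
Unset Strict Implicit.
Unset Printing Implicit Defensive.

Import Order.TTheory GRing.Theory Num.Theory.
Import numFieldNormedType.Exports.

Local Open Scope classical_set_scope.
Local Open Scope ring_scope.

(* The library's norm on matrices is the sup norm; this is the l2 norm. *)
Definition norm2 (R : realType) (p q : nat) (A : 'M[R]_(p, q)) : R :=
  Num.sqrt (\sum_i \sum_j A i j ^+ 2).

Definition borel_set (R : realType) (m : nat) : set (set 'cV[R]_m) :=
  <<s @open 'cV[R]_m >>.

Notation relvec m n := {ffun 'I_m -> 'I_n.+1}.

Definition gain (R : realType) (a : nat) : R := 2 ^+ a - 1.

Definition log2 (R : realType) (x : R) : R := ln x / ln 2.

(* Permutations map ranks to documents.  Ranks are counted from 0, so the
   discount 1 / log2 (1 + rank) becomes 1 / log2 (rank + 2). *)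
Definition dcg (R : realType) (m n : nat) (sigma : 'S_m) (r : relvec m n) : R :=
  \sum_(i < m) gain R (r i) / log2 (((sigma^-1)%g i).+2%:R).

(* The summands of dcg are nonnegative, so the default value 0 of the iterated
   maximum is harmless. *)
Definition Z (R : realType) (m n : nat) (r : relvec m n) : R :=
  \big[Num.max/0]_(sigma : 'S_m) dcg R sigma r.

(* If r = 0, then Z r = 0 and, since 0 / 0 = 0, this is the zero vector. *)
Definition normalized_gain (R : realType) (m n : nat) (r : relvec m n) :
    'cV[R]_m :=
  \col_i (gain R (r i) / Z R r).

Definition distribution_on (R : realType) (I : finType) (q : I -> R) : Prop :=
  (forall i, 0 <= q i) /\ \sum_i q i = 1.

Definition surrogate (R : realType) (m n : nat) : Type :=
  'cV[R]_m -> relvec m n -> R.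

Definition risk (R : realType) (m n : nat) (phi : surrogate R m n)
    (s : 'cV[R]_m) (q : relvec m n -> R) : R :=
  \sum_r q r * phi s r.

Definition risk_minimizer (R : realType) (m n : nat) (phi : surrogate R m n)
    (q : relvec m n -> R) (s : 'cV[R]_m) : Prop :=
  forall s' : 'cV[R]_m, risk phi s q <= risk phi s' q.

Definition unique_risk_minimizers (R : realType) (m n : nat)
    (phi : surrogate R m n) : Prop :=
  forall q : relvec m n -> R, distribution_on q ->
    exists! s : 'cV[R]_m, risk_minimizer phi q s.

Definition order_preserving (R : realType) (m : nat)
    (g : 'cV[R]_m -> 'cV[R]_m) : Prop :=
  forall (x : 'cV[R]_m) (i j : 'I_m), x i 0 > x j 0 -> g x i 0 > g x j 0.

Definition ndcg_calibrated (R : realType) (m n : nat)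
    (phi : surrogate R m n) : Prop :=
  forall (q : relvec m n -> R) (s : 'cV[R]_m),
    distribution_on q -> risk_minimizer phi q s ->
    exists g : 'cV[R]_m -> 'cV[R]_m,
      [/\ bijective g, order_preserving g &
          s = g (\sum_r q r *: normalized_gain R r)].

Definition borel_surrogate (R : realType) (m n : nat)
    (phi : surrogate R m n) : Prop :=
  forall (r : relvec m n) (B : set R),
    measurable B -> borel_set [set s | B (phi s r)].

(* A sorting rule: descending order of the scores, with an arbitrary (Borel)
   way of breaking ties. *)
Definition is_argsort (R : realType) (m : nat)
    (argsort : 'cV[R]_m -> 'S_m) : Prop :=
  (forall (s : 'cV[R]_m) (k l : 'I_m), (k <= l)%N ->
     s (argsort s l) 0 <= s (argsort s k) 0) /\
  (forall pi : 'S_m, borel_set [set s | argsort s = pi]).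

(* The score at a round depends on the internal randomness w, the document
   matrices shown so far (the current one included) and the feedback received
   at the previous rounds.  The learner's own past scores are functions of
   these data. *)
Record learner (R : realType) (m n d : nat) (disp : measure_display)
    (Omega : measurableType disp) := Learner {
  score :> Omega -> seq 'M[R]_(m, d) -> seq 'I_n.+1 -> 'cV[R]_m ;
  measurable_score : forall (Xs : seq 'M[R]_(m, d)) (ys : seq 'I_n.+1)
    (B : set 'cV[R]_m), borel_set B -> measurable [set w | B (score w Xs ys)]
}.

Section Game.
Variables (R : realType) (m n d : nat) (m_gt0 : (0 < m)%N).
Variables (disp : measure_display) (Omega : measurableType disp).
Variables (phi : surrogate R m n) (argsort : 'cV[R]_m -> 'S_m).
Variables (A : learner R m n d Omega).
Variables (X : nat -> 'M[R]_(m, d)) (rel : nat -> relvec m n).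

Definition top_document (s : 'cV[R]_m) : 'I_m := argsort s (Ordinal m_gt0).

(* Feedback observed during the first t rounds; rounds are numbered from 0. *)
Fixpoint feedback (w : Omega) (t : nat) : seq 'I_n.+1 :=
  if t is t'.+1 then
    rcons (feedback w t')
      (rel t' (top_document (A w (mkseq X t'.+1) (feedback w t'))))
  else [::].

Definition played (w : Omega) (t : nat) : 'cV[R]_m :=
  A w (mkseq X t.+1) (feedback w t).

(* Surrogates with risk minimizers at all point masses are bounded below in
   the score, so the expectation below is well defined, possibly +oo. *)
Definition expected_regret (P : probability Omega R) (U : R) (T : nat) :
    \bar R :=
  ('E_P[fun w => (\sum_(0 <= t < T) phi (played w t) (rel t))%R]
   - ereal_inf [set (\sum_(0 <= t < T) phi (X t *m v) (rel t))%R%:E |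
                 v in [set v : 'cV[R]_d | (norm2 v <= U)%R]])%E.

End Game.

(* Main.v *)
(* There are two laws of relevance vectors under which every single document
   has the same relevance distribution, but which order the expected normalized
   gains of two documents oppositely.  Top-1 feedback cannot distinguish them,
   while NDCG calibration forces their risk minimizers s1 and s2 to differ.  By
   uniqueness of the minimizer of the averaged risk, no score is optimal for
   both laws, and the sum of the two excess risks is bounded away from 0.
   Document matrices with columns s1 / U and s2 / U let a weight of norm U
   realize either minimizer, so averaging over all relevance sequences drawn
   from either law produces a sequence of linear regret. *)
Require Import Defs.
From HB Require Import structures.
From mathcomp Require Import all_boot all_order all_algebra all_fingroup.
From mathcomp Require Import all_classical all_reals all_analysis.
From mathcomp Require Import measurable_realfun ring lra.

Set Implicit Arguments.
Unset Strict Implicit.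
Unset Printing Implicit Defensive.

Import Order.TTheory GRing.Theory Num.Theory.
Import numFieldNormedType.Exports.

Local Open Scope classical_set_scope.
Local Open Scope ring_scope.

(** * Monotonicity, scaling and symmetry of the NDCG normalization *)

Section Gains.
Variables (R : realType) (m n : nat).
Implicit Types (r : relvec m n) (sigma p : 'S_m).

Lemma log2_gt0 (k : nat) : 0 < log2 (k.+2%:R : R).
Proof. by rewrite /log2 divr_gt0 ?ln_gt0 ?ltr1n. Qed.

Lemma gain_ge0 (a : nat) : 0 <= gain R a.
Proof. by rewrite /gain subr_ge0 exprn_ege1 ?ler1n. Qed.

Lemma dcg_ge0 sigma r : 0 <= dcg R sigma r.
Proof.
by apply: sumr_ge0 => i _; rewrite divr_ge0 ?gain_ge0 // ltW // log2_gt0.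
Qed.

Lemma dcg_lt sigma r r' : (forall i, (r i <= r' i)%N) ->
  (exists i, (r i < r' i)%N) -> dcg R sigma r < dcg R sigma r'.
Proof.
move=> le_r [i lt_r]; rewrite /dcg (bigD1 i) //= [ltRHS](bigD1 i) //=.
apply: ltr_leD; first by rewrite ltr_pM2r ?invr_gt0 ?log2_gt0 // /gain ltrD2r
  ltr_eXn2l ?ltr1n.
apply: ler_sum => j _; rewrite ler_pM2r ?invr_gt0 ?log2_gt0 //.
by rewrite /gain lerD2r ler_eXn2l ?ltr1n.
Qed.

Lemma dcg_le_Z sigma r : dcg R sigma r <= Z R r.
Proof. exact: (le_bigmax _ (fun sigma => dcg R sigma r)). Qed.

Lemma Z_lt r r' : (forall i, (r i <= r' i)%N) ->
  (exists i, (r i < r' i)%N) -> Z R r < Z R r'.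
Proof.
move=> le_r lt_r; apply/bigmax_ltP; split=> [|sigma _].
  (* The default 0 of the iterated maximum must also lie strictly below [Z R r']; the identity
     ranking shows it. *)
  have := dcg_le_Z 1%g r'; apply: lt_le_trans.
  exact: le_lt_trans (dcg_ge0 1%g r) (dcg_lt 1%g le_r lt_r).
exact: lt_le_trans (dcg_lt sigma le_r lt_r) (dcg_le_Z sigma r').
Qed.

Lemma Z_gt0 r : (exists i, (0 < r i)%N) -> 0 < Z R r.
Proof.
move=> r_gt0; suff: Z R ([ffun=> ord0] : relvec m n) < Z R r.
  move=> lt_Z; apply: le_lt_trans lt_Z.
  exact: le_trans (dcg_ge0 1%g _) (dcg_le_Z 1%g _).
by apply: Z_lt => [i|]; [|case: r_gt0 => i ri; exists i]; rewrite ffunE.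
Qed.

Lemma Z_ge_scale (a : R) r r' : 0 < a ->
  (forall i, gain R (r' i) = a * gain R (r i)) -> a * Z R r <= Z R r'.
Proof.
move=> a_gt0 scale; rewrite mulrC -ler_pdivlMr //.
have dcgE sigma : dcg R sigma r' = a * dcg R sigma r.
  by rewrite /dcg mulr_sumr; apply: eq_bigr => i _; rewrite scale mulrA.
apply: bigmax_le => [|sigma _].
  by rewrite divr_ge0 ?(ltW a_gt0) ?(le_trans (dcg_ge0 1%g _) (dcg_le_Z 1%g _)).
by rewrite ler_pdivlMr // mulrC -dcgE dcg_le_Z.
Qed.

(** Relabelling documents by [q] only reindexes the rankings in the maximum, through [sigma * q].
    This gives one inequality; the other is the same one for the inverse permutation. *)
Lemma Z_perm p r : Z R [ffun i => r (p i)] = Z R r.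
Proof.
have le_perm (q : 'S_m) (r' : relvec m n) : Z R [ffun i => r' (q i)] <= Z R r'.
  apply: bigmax_le => [|sigma _].
    exact: le_trans (dcg_ge0 1%g _) (dcg_le_Z 1%g _).
  apply: le_trans (dcg_le_Z (sigma * q)%g r').
  rewrite /dcg [leRHS](reindex_inj (@perm_inj _ q)) /=.
  by apply: ler_sum => i _; rewrite ffunE invMg permM permK.
apply/eqP; rewrite eq_le le_perm /=.
have {1}-> : r = [ffun i => [ffun j => r (p j)] (p^-1%g i)].
  by apply/ffunP => i; rewrite !ffunE permKV.
exact: le_perm.
Qed.

End Gains.

(** * Samples of relevance vectors with equal marginals and opposite gain orders *)

Section ConfusablePair.
Variables (R : realType) (m n : nat) (i0 i1 : 'I_m).
Hypothesis i01 : i1 != i0.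

Definition rel3 (a b c : 'I_n.+1) : relvec m n :=
  [ffun i => if i == i0 then a else if i == i1 then b else c].

Lemma rel3_swap a b c : Z R (rel3 b a c) = Z R (rel3 a b c).
Proof.
rewrite -(Z_perm R (tperm i0 i1)); congr (Z R _); apply/ffunP => i.
rewrite !ffunE; case: tpermP => [->|->|/eqP/negPf-> /eqP/negPf-> //];
  by rewrite ?eqxx ?(negPf i01).
Qed.

(** The second sample exchanges the grades of [i0] and [i1] in the first. This preserves [Z], hence
    reverses the gain difference, while marginals agree because [a] and [b] list the same grades
    with the same multiplicities. *)
Lemma swap_separates k (a b c : 'I_k.+1 -> 'I_n.+1) :
  (forall H : 'I_n.+1 -> R, \sum_l H (a l) = \sum_l H (b l)) ->
  0 < \sum_l (gain R (a l) - gain R (b l)) / Z R (rel3 (a l) (b l) (c l)) ->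
  exists rho1 rho2 : 'I_k.+1 -> relvec m n,
    [/\ forall i (H : 'I_n.+1 -> R), \sum_l H (rho1 l i) = \sum_l H (rho2 l i),
        (\sum_l normalized_gain R (rho1 l)) i1 0 <
        (\sum_l normalized_gain R (rho1 l)) i0 0 &
        (\sum_l normalized_gain R (rho2 l)) i0 0 <
        (\sum_l normalized_gain R (rho2 l)) i1 0].
Proof.
move=> ab_law ab_gt.
exists (fun l => rel3 (a l) (b l) (c l)), (fun l => rel3 (b l) (a l) (c l)).
split=> [i H||].
- under eq_bigr do rewrite ffunE; under [RHS]eq_bigr do rewrite ffunE.
  by case: eqP => // _; case: eqP.
- rewrite !summxE -subr_gt0 -sumrB; congr (0 < _): ab_gt.
  by apply: eq_bigr => l _; rewrite !mxE !ffunE eqxx (negPf i01) eqxx mulrBl.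
- rewrite !summxE -subr_gt0 -sumrB; congr (0 < _): ab_gt.
  apply: eq_bigr => l _.
  by rewrite !mxE !ffunE eqxx (negPf i01) eqxx rel3_swap mulrBl.
Qed.

End ConfusablePair.

(* For three documents, swapping the first two moves the third, relevant
   document from one of them to the other, which changes the normalization but
   no marginal.  For two documents the sample runs around the cycle
   0 -> 1 -> 2 -> 0, and only the pair (2, 1) is damped by the normalization. *)
Lemma confusable_samples (R : realType) (m n : nat) :
  (1 < m)%N -> (0 < n)%N -> (m, n) <> (2%N, 1%N) ->
  exists (k : nat) (rho1 rho2 : 'I_k.+1 -> relvec m n) (i j : 'I_m),
    [/\ forall i (H : 'I_n.+1 -> R), \sum_l H (rho1 l i) = \sum_l H (rho2 l i),
        (\sum_l normalized_gain R (rho1 l)) j 0 <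
        (\sum_l normalized_gain R (rho1 l)) i 0 &
        (\sum_l normalized_gain R (rho2 l)) i 0 <
        (\sum_l normalized_gain R (rho2 l)) j 0].
Proof.
move=> m_gt1 n_gt0 mn_neq.
pose i0 := Ordinal (ltnW m_gt1); pose i1 := Ordinal m_gt1.
have i01 : i1 != i0 by [].
have v1 : nat_of_ord (inord 1 : 'I_n.+1) = 1%N by rewrite inordK.
have g0 : gain R 0 = 0 by rewrite /gain expr0 subrr.
have g1 : gain R 1 = 1 by rewrite /gain expr1; lra.
have g2 : gain R 2 = 3 by rewrite /gain expr2; lra.
pose Z3 a b c := Z R (rel3 i0 i1 a b c : relvec m n).
have Z3_gt0 (a b c : 'I_n.+1) : (0 < a)%N -> 0 < Z3 a b c.
  by move=> a_gt0; apply: Z_gt0; exists i0; rewrite ffunE eqxx.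
have [m_gt2|m_le2] := ltnP 2 m.
  pose i2 := Ordinal m_gt2.
  pose bit (b : bool) : 'I_n.+1 := if b then inord 1 else ord0.
  (* The two vectors are (1,0,0,...) and (0,1,1,...). By swap symmetry the required sign says that
     (1,0,1,...) has a strictly larger [Z] than (1,0,0,...); [i2] witnesses strictness. *)
  pose a (l : 'I_2) := bit (l == ord0); pose b (l : 'I_2) := bit (l != ord0).
  have [||rho1 [rho2 sep]] := @swap_separates R m n i0 i1 i01 1 a b b.
  - by move=> H; rewrite !big_ord_recl !big_ord0 /a /b /= !addr0 addrC.
  - rewrite !big_ord_recl !big_ord0 /a /b /= v1 g0 g1.
    rewrite (rel3_swap R i01 (inord 1) ord0 (inord 1)).
    rewrite addr0 subr0 sub0r mulN1r mul1r subr_gt0.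
    rewrite ltf_pV2 ?posrE ?Z3_gt0 ?v1 //; apply: Z_lt => [i|].
      by rewrite !ffunE; do 2![case: ifP => // _].
    by exists i2; rewrite !ffunE /= v1.
  by exists 1%N, rho1, rho2, i0, i1.
have {m_le2} m2 : m = 2%N by apply/eqP; rewrite eqn_leq m_le2.
(* Excluding (2, 1) makes grade 2 available for two documents. *)
have n_gt1 : (1 < n)%N.
  by case: n n_gt0 mn_neq {v1 Z3 Z3_gt0} => [|[|n]] // _; rewrite m2.
have v2 : nat_of_ord (inord 2 : 'I_n.+1) = 2%N by rewrite inordK.
pose e k : 'I_n.+1 := inord k.
pose a (l : 'I_3) := e (nth 0%N [:: 1; 2; 0]%N l).
pose b (l : 'I_3) := e (nth 0%N [:: 0; 1; 2]%N l).
have [||rho1 [rho2 sep]] := @swap_separates R m n i0 i1 i01 2 a b (fun=> e 0%N).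
- move=> H; rewrite !big_ord_recl !big_ord0 /a /b /= !addr0.
  by rewrite [RHS]addrC addrA.
- rewrite !big_ord_recl !big_ord0 /a /b /= /e v1 v2 inordK // g0 g1 g2.
  rewrite (rel3_swap _ i01 (inord 2)).
  (* Grade 2 has three times the gain of grade 1, so [3 / Z(2,0) <= 1 / Z(1,0)], and the sum
     [1 / Z(1,0) + 2 / Z(2,1) - 3 / Z(2,0)] is at least [2 / Z(2,1)]. *)
  have scale : 3 * Z3 (inord 1) (inord 0) (inord 0)
               <= Z3 (inord 2) (inord 0) (inord 0).
    apply: Z_ge_scale => // i; rewrite !ffunE.
    by case: ifP => _; rewrite ?if_same ?v1 ?v2 ?inordK // ?g0 ?g1 ?g2 ?mulr0
      ?mulr1.
  have p1 : 0 < Z3 (inord 1) (inord 0) (inord 0) by rewrite Z3_gt0 ?v1.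
  have p2 : 0 < Z3 (inord 2) (inord 1) (inord 0) by rewrite Z3_gt0 ?v2.
  have p3 : 0 < (Z3 (inord 2) (inord 1) (inord 0))^-1 by rewrite invr_gt0.
  have : (Z3 (inord 2) (inord 0) (inord 0))^-1
         <= (3 * Z3 (inord 1) (inord 0) (inord 0))^-1.
    by rewrite lef_pV2 // posrE ?mulr_gt0 // Z3_gt0 ?v2.
  rewrite invfM -/(Z3 _ _ _) -/(Z3 _ _ _) -/(Z3 _ _ _); lra.
by exists 2%N, rho1, rho2, i0, i1.
Qed.

(** * Empirical laws of finite samples *)

Section Sampling.
Variables (R : realType) (m n k : nat).
Implicit Types (rho : 'I_k.+1 -> relvec m n).

Definition sample_law rho (r : relvec m n) : R :=
  k.+1%:R^-1 * \sum_l (rho l == r)%:R.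

(** Module-valued [f] covers both real risks and gain vectors. *)
Lemma sum_sample_law (V : lmodType R) rho (f : relvec m n -> V) :
  \sum_r sample_law rho r *: f r = k.+1%:R^-1 *: \sum_l f (rho l).
Proof.
under eq_bigr do rewrite /sample_law -scalerA scaler_suml.
rewrite -scaler_sumr exchange_big; congr (_ *: _); apply: eq_bigr => l _.
rewrite (bigD1 (rho l)) //= eqxx scale1r big1 ?addr0 // => r ne_r.
by rewrite eq_sym (negPf ne_r) scale0r.
Qed.

Lemma risk_sample_law (phi : surrogate R m n) rho s :
  risk phi s (sample_law rho) = k.+1%:R^-1 * \sum_l phi s (rho l).
Proof. exact: (@sum_sample_law R^o). Qed.

Lemma sample_law_distribution rho : distribution_on (sample_law rho).
Proof.
split=> [r|]; first by rewrite mulr_ge0 ?invr_ge0 ?sumr_ge0.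
have := @sum_sample_law R^o rho (fun=> 1).
rewrite sumr_const card_ord -[_ *: _]/(_ * _) mulVf ?pnatr_eq0 // => <-.
by apply: eq_bigr => r _; rewrite -[_ *: _]/(_ * _) mulr1.
Qed.

End Sampling.

(** * Averages over all words of sample indices *)

Section Words.
Variable k : nat.

(** Averaging over this list stands for independent uniform draws. Words grow at the end, so
    induction on [T] adds the last round. *)
Fixpoint words (T : nat) : seq (seq 'I_k.+1) :=
  if T is T'.+1 then [seq rcons s l | s <- words T', l <- enum 'I_k.+1]
  else [:: [::]].

Lemma size_mem_words T s : s \in words T -> size s = T.
Proof.
elim: T s => [|T IH] s /=; first by rewrite inE => /eqP->.
by move=> /allpairsP[[s' l] [/= /IH <- _ ->]]; rewrite size_rcons.
Qed.

Lemma size_words_gt0 T : (0 < size (words T))%N.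
Proof.
by elim: T => //= T IH; rewrite size_allpairs muln_gt0 IH size_enum_ord.
Qed.

Lemma size_wordsS T : size (words T.+1) = (size (words T) * k.+1)%N.
Proof. by rewrite size_allpairs size_enum_ord. Qed.

Lemma sum_wordsS (V : nmodType) T (F : seq 'I_k.+1 -> V) :
  \sum_(s <- words T.+1) F s = \sum_(s <- words T) \sum_l F (rcons s l).
Proof.
by rewrite big_allpairs_dep; apply: eq_bigr => s _; rewrite big_enum.
Qed.

Lemma sum_const_seq (R : pzSemiRingType) (I : Type) (r : seq I) (x : R) :
  \sum_(i <- r) x = (size r)%:R * x.
Proof. by rewrite big_const_seq count_predT iter_addr_0 mulr_natl. Qed.

(** Each position of a uniform word is a uniform letter, so every round contributes the mean [v] of
    [f]. *)
Lemma sum_words_letters (R : realType) T (f : 'I_k.+1 -> R) (v : R) :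
  \sum_l f l = k.+1%:R * v ->
  \sum_(s <- words T) \sum_(0 <= t < T) f (nth ord0 s t)
  = (size (words T))%:R * (T%:R * v).
Proof.
move=> fv; elim: T => [|T IH].
  by rewrite big_seq1 big_nat_cond big_pred0 ?mul0r ?mulr0 // => t; rewrite ltn0 andbF.
rewrite sum_wordsS size_wordsS.
transitivity (\sum_(s <- words T)
    (k.+1%:R * \sum_(0 <= t < T) f (nth ord0 s t) + k.+1%:R * v)).
  apply: eq_big_seq => s /size_mem_words size_s.
  have constE (c : R) : k.+1%:R * c = \sum_(l < k.+1) c.
    by rewrite sumr_const card_ord mulr_natl.
  rewrite -fv constE -big_split /=.
  apply: eq_bigr => l _; rewrite big_nat_recr //= nth_rcons size_s ltnn eqxx.
  congr (_ + _); apply: eq_big_nat => t /= lt_t.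
  by rewrite nth_rcons size_s lt_t.
rewrite big_split /= -mulr_sumr IH sum_const_seq natrM -[T.+1]addn1 natrD; ring.
Qed.

End Words.

(** * Feedback and loss against adversaries driven by words *)

Section AdversarySequences.
Variables (R : realType) (m n d : nat) (m_gt0 : (0 < m)%N).
Variables (disp : measure_display) (Omega : measurableType disp).
Variables (phi : surrogate R m n) (argsort : 'cV[R]_m -> 'S_m).
Variables (A : learner R m n d Omega) (X : nat -> 'M[R]_(m, d)).
Variables (k : nat).
Implicit Types (rho : 'I_k.+1 -> relvec m n) (w : Omega).

(** A word of length [T] covers exactly the rounds 0 to [T - 1]; later rounds read the default index
    [ord0]. *)
Definition word_rel rho (s : seq 'I_k.+1) (t : nat) : relvec m n :=
  rho (nth ord0 s t).

Definition loss rho T s w : R :=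
  \sum_(0 <= t < T)
     phi (played m_gt0 argsort A X (word_rel rho s) w t) (word_rel rho s t).

Local Notation fb rho s w T :=
  (feedback m_gt0 argsort A X (word_rel rho s) w T).

Lemma eq_feedback (rel rel' : nat -> relvec m n) w T :
  (forall t, (t < T)%N -> rel t = rel' t) ->
  feedback m_gt0 argsort A X rel w T = feedback m_gt0 argsort A X rel' w T.
Proof.
elim: T => //= T IH eq_rel.
by rewrite IH ?eq_rel // => t lt_t; apply: eq_rel; apply: ltnW.
Qed.

Lemma word_rel_rcons rho s l t : (t < size s)%N ->
  word_rel rho (rcons s l) t = word_rel rho s t.
Proof. by rewrite /word_rel nth_rcons => ->. Qed.

Lemma word_rel_last rho s l : word_rel rho (rcons s l) (size s) = rho l.
Proof. by rewrite /word_rel nth_rcons ltnn eqxx. Qed.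

Lemma feedback_rcons rho s l w t : (t <= size s)%N ->
  fb rho (rcons s l) w t = fb rho s w t.
Proof.
by move=> le_t; apply: eq_feedback => t' lt_t'; rewrite word_rel_rcons //
  (leq_trans lt_t').
Qed.

(** The last score is fixed before the last letter is revealed, so that letter enters only through
    the final loss. *)
Lemma loss_rcons rho s l w :
  loss rho (size s).+1 (rcons s l) w =
  loss rho (size s) s w
  + phi (A w (mkseq X (size s).+1) (fb rho s w (size s))) (rho l).
Proof.
rewrite /loss big_nat_recr //= word_rel_last /played feedback_rcons //.
congr (_ + _); apply: eq_big_nat => t /= lt_t.
by rewrite word_rel_rcons // /played feedback_rcons // ltnW.
Qed.

Section SameMarginals.
Variables rho1 rho2 : 'I_k.+1 -> relvec m n.
Hypothesis marginals : forall i (H : 'I_n.+1 -> R),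
  \sum_l H (rho1 l i) = \sum_l H (rho2 l i).

(** Past feedback fixes the top document, and the new symbol is the grade of that single document,
    whose law is the same for both samples. Keeping [F] arbitrary lets the induction absorb the last
    letter into a new functional. *)
Lemma sum_feedback_marginals w T (F : seq 'I_n.+1 -> R) :
  \sum_(s <- words k T) F (fb rho1 s w T) =
  \sum_(s <- words k T) F (fb rho2 s w T).
Proof.
elim: T F => [|T IH] F; first by rewrite !big_seq1.
pose top t y := top_document m_gt0 argsort (A w (mkseq X t.+1) y).
have step rho : \sum_(s <- words k T.+1) F (fb rho s w T.+1) =
    \sum_(s <- words k T) \sum_l
       F (rcons (fb rho s w T) (rho l (top T (fb rho s w T)))).
  rewrite sum_wordsS; apply: eq_big_seq => s /size_mem_words <-.
  by apply: eq_bigr => l _; rewrite /= word_rel_last feedback_rcons.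
rewrite !step -[RHS](IH (fun y => \sum_l F (rcons y (rho2 l (top T y))))).
by apply: eq_bigr => s _; exact: (marginals _ (fun y => F (rcons _ y))).
Qed.

(* The scores have the same distribution under both samples, so each of them
   is charged with both risks at once. *)
Lemma total_loss_ge w T (v : R) :
  (forall s, k.+1%:R * v <= \sum_l phi s (rho1 l) + \sum_l phi s (rho2 l)) ->
  (size (words k T))%:R * (T%:R * v) <=
  \sum_(s <- words k T) loss rho1 T s w + \sum_(s <- words k T) loss rho2 T s w.
Proof.
move=> le_v; elim: T => [|T IH].
  by rewrite !big_seq1 /loss !big_geq // mul0r mulr0 addr0.
pose play t y := A w (mkseq X t.+1) y.
have step rho : \sum_(s <- words k T.+1) loss rho T.+1 s w =
    k.+1%:R * (\sum_(s <- words k T) loss rho T s w) +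
    \sum_(s <- words k T) \sum_l phi (play T (fb rho s w T)) (rho l).
  rewrite sum_wordsS mulr_sumr -big_split /=.
  apply: eq_big_seq => s /size_mem_words <-.
  under eq_bigr do rewrite loss_rcons.
  by rewrite big_split /= sumr_const card_ord mulr_natl.
rewrite !step (sum_feedback_marginals w T (fun y => \sum_l phi (play T y) (rho1 l))).
have : (size (words k T))%:R * (k.+1%:R * v) <=
    \sum_(s <- words k T) \sum_l phi (play T (fb rho2 s w T)) (rho1 l)
    + \sum_(s <- words k T) \sum_l phi (play T (fb rho2 s w T)) (rho2 l).
  by rewrite -sum_const_seq -big_split; apply: ler_sum => s _; exact: le_v.
have : k.+1%:R * ((size (words k T))%:R * (T%:R * v)) <=
    k.+1%:R * (\sum_(s <- words k T) loss rho1 T s w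
               + \sum_(s <- words k T) loss rho2 T s w).
  by rewrite ler_pM2l.
rewrite size_wordsS natrM -[T.+1]addn1 natrD; lra.
Qed.

End SameMarginals.
End AdversarySequences.

(** * Measurability of feedback and losses *)

Section Measurability.
Variables (R : realType) (m n d : nat) (m_gt0 : (0 < m)%N).
Variables (disp : measure_display) (Omega : measurableType disp).
Variables (phi : surrogate R m n) (argsort : 'cV[R]_m -> 'S_m).
Hypotheses (argsortP : is_argsort argsort) (phi_borel : borel_surrogate phi).
Variables (A : learner R m n d Omega) (X : nat -> 'M[R]_(m, d)).
Variable rel : nat -> relvec m n.

(** With earlier feedback frozen to [ys], the score is measurable in the randomness alone, and the
    last symbol depends only on which of finitely many permutations it induces. *)
Lemma measurable_feedback_eq t (ys : seq 'I_n.+1) :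
  measurable [set w | feedback m_gt0 argsort A X rel w t = ys].
Proof.
elim: t ys => [|t IH] ys /=.
  by have [->|ne] := eqVneq ys [::];
    [rewrite (_ : mkset _ = setT) | rewrite (_ : mkset _ = set0)] => //;
    apply/seteqP; split=> // w /= /esym/eqP; rewrite (negPf ne).
case/lastP: ys => [|ys y].
  rewrite (_ : mkset _ = set0) //; apply/seteqP; split=> // w /=.
  by move/(congr1 size); rewrite size_rcons.
rewrite (_ : mkset _ = [set w | feedback m_gt0 argsort A X rel w t = ys] `&`
  \bigcup_(p in [set p : 'S_m | rel t (p (Ordinal m_gt0)) = y])
    [set w | argsort (A w (mkseq X t.+1) ys) = p]).
  apply: measurableI; first exact: IH.
  apply: fin_bigcup_measurable => [|p _]; first exact: finite_finset.
  exact: (measurable_score _ _ _ (argsortP.2 p)).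
apply/seteqP; split=> w /=.
  by move/rcons_inj=> [<- <-]; split=> //; eexists; last reflexivity.
by move=> [-> [p /= <- <-]].
Qed.

(** Feedback takes countably many values, and on each of these events the score is taken at a
    constant sequence. *)
Lemma measurable_played_loss t r :
  measurable_fun setT (fun w => phi (played m_gt0 argsort A X rel w t) r).
Proof.
move=> _ B mB; rewrite setTI.
rewrite (_ : _ @^-1` _ = \bigcup_(ys in [set: seq 'I_n.+1])
  ([set w | feedback m_gt0 argsort A X rel w t = ys] `&`
   [set w | B (phi (A w (mkseq X t.+1) ys) r)])).
  apply: countable_bigcupT_measurable => [|ys]; first exact: countableP.
  apply: measurableI; first exact: measurable_feedback_eq.
  exact: (measurable_score _ _ _ (phi_borel r mB)).
apply/seteqP; split=> w /=; first by move=> Bw; eexists.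
by move=> [ys _ [<-]].
Qed.

End Measurability.

(** * Integrating pointwise bounds on sums of losses *)

Section ExpectationAverage.
Context (disp : measure_display) (Omega : measurableType disp) (R : realType).
Variable P : probability Omega R.

(** The lower bound makes the negative part integrable; an infinite positive part would then force
    the expectation to be [+oo]. *)
Lemma integrable_lower_bounded (f : Omega -> R) (C : R) :
  measurable_fun setT f -> (forall w, C <= f w) -> ('E_P[f] < +oo)%E ->
  P.-integrable setT (EFin \o f).
Proof.
move=> mf leC; rewrite unlock => Ef.
have mEf : measurable_fun setT (EFin \o f) by exact/measurable_EFinP.
have fneg : (\int[P]_w (EFin \o f)^\- w <= `|C|%:E)%E.
  rewrite -[leRHS]mule1 -(probability_setT P) -integral_cst //.
  apply: ge0_le_integral => //; first exact: measurable_funeneg.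
  move=> w _; rewrite funenegE /= -EFin_max lee_fin ge_max normr_ge0 andbT.
  by rewrite lerNl (le_trans (lerNnormlW (lexx _)) (leC w)).
have neg_lty := le_lt_trans fneg (ltry _).
apply/integrableP; split=> //.
rewrite (_ : (fun _ => _) = (EFin \o f)^\+ \+ (EFin \o f)^\-)%E; last first.
  by rewrite -fune_abse.
rewrite ge0_integralD //; [|exact: measurable_funepos|exact: measurable_funeneg].
apply: lte_add_pinfty; last exact: neg_lty.
have neg_fin : (\int[P]_w (EFin \o f)^\- w)%E \is a fin_num.
  by rewrite ge0_fin_numE // integral_ge0.
rewrite ltey; apply: contraTneq Ef => pos_y.
rewrite integralE pos_y addye //.
by move: neg_fin; rewrite -fin_numN fin_numE => /andP[].
Qed.

(** The bounds [C] and [u] make each [f i] integrable, so expectation commutes with the finite sum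
    and the pointwise bound integrates. *)
Lemma le_sum_expectation_bounds (I : Type) (r : seq I) (f : I -> Omega -> R)
    (C u : I -> R) (a : R) :
  (forall i, measurable_fun setT (f i)) -> (forall i w, C i <= f i w) ->
  (forall i, ('E_P[f i] <= (u i)%:E)%E) ->
  (forall w, a <= \sum_(i <- r) f i w) -> a <= \sum_(i <- r) u i.
Proof.
move=> mf leC Eu le_a.
have intf i : P.-integrable setT (EFin \o f i).
  by apply: integrable_lower_bounded (leC i) _ => //; exact: le_lt_trans (Eu i) (ltry _).
rewrite -lee_fin -sumEFin.
apply: (@le_trans _ _ (\sum_(i <- r) 'E_P[f i])%E); last first.
  by apply: lee_sum => i _.
have -> : (\sum_(i <- r) 'E_P[f i] =
    \int[P]_w (\sum_(i <- r) (EFin \o f i) w))%E.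
  by rewrite integral_sum //; apply: eq_bigr => i _; rewrite unlock.
rewrite -[leLHS]mule1 -(probability_setT P) -integral_cst //.
apply: le_integral => //.
- exact: finite_measure_integrable_cst.
- by apply: integrable_sum.
- by move=> w _ /=; rewrite sumEFin lee_fin.
Qed.

End ExpectationAverage.

(** * Consequences of unique minimizers and calibration *)

(** The risk at the point mass on [r] is [phi s r] itself, and it has a minimizer. *)
Lemma surrogate_lower_bound (R : realType) (m n : nat) (phi : surrogate R m n)
    (r : relvec m n) : unique_risk_minimizers phi ->
  exists C, forall s, C <= phi s r.
Proof.
pose rho (_ : 'I_1) := r.
move=> /(_ _ (sample_law_distribution R rho))[s0 [min_s0 _]].
exists (phi s0 r) => s; have := min_s0 s.
by rewrite !risk_sample_law !big_ord1 invr1 !mul1r.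
Qed.

Lemma normalized_gain_separates (R : realType) (m n k : nat)
    (phi : surrogate R m n) (rho : 'I_k.+1 -> relvec m n) s i j :
  ndcg_calibrated phi -> risk_minimizer phi (sample_law R rho) s ->
  (\sum_l normalized_gain R (rho l)) j 0 <
    (\sum_l normalized_gain R (rho l)) i 0 -> s j 0 < s i 0.
Proof.
move=> cal min_s lt_ji.
have [g [_ g_mono ->]] := cal _ _ (sample_law_distribution R rho) min_s.
apply: g_mono; rewrite sum_sample_law !mxE.
by rewrite ltr_pM2l ?invr_gt0 // -!summxE.
Qed.

(* Equality in [v1 + v2 <= v] would make the minimizer of the averaged risk
   minimize both risks, contradicting their distinct minimizers. *)
Lemma minimal_risk_gap (R : realType) (m n : nat) (phi : surrogate R m n)
    (q1 q2 : relvec m n -> R) (s1 s2 : 'cV[R]_m) :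
  unique_risk_minimizers phi -> distribution_on q1 -> distribution_on q2 ->
  risk_minimizer phi q1 s1 -> risk_minimizer phi q2 s2 -> s1 != s2 ->
  exists2 v, risk phi s1 q1 + risk phi s2 q2 < v &
    forall s, v <= risk phi s q1 + risk phi s q2.
Proof.
move=> phi_min q1P q2P min1 min2 ne12.
pose q r := 2^-1 * (q1 r + q2 r).
have riskq s : risk phi s q = 2^-1 * (risk phi s q1 + risk phi s q2).
  rewrite /risk -big_split mulr_sumr; apply: eq_bigr => r _ /=.
  by rewrite /q -mulrDl mulrA.
have qP : distribution_on q.
  split=> [r|]; first by rewrite mulr_ge0 ?addr_ge0 ?q1P.1 ?q2P.1.
  by rewrite -mulr_sumr big_split /= q1P.2 q2P.2; field.
have [s0 [min0 _]] := phi_min q qP.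
exists (risk phi s0 q1 + risk phi s0 q2) => [|s]; last first.
  by have := min0 s; rewrite !riskq ler_pM2l.
have {min0} := min1 s0; have := min2 s0.
rewrite le_eqVlt => /orP[/eqP e2|]; last by move=> ? ?; rewrite ler_ltD.
rewrite le_eqVlt => /orP[/eqP e1|]; last by rewrite e2 ltrD2r.
have [t1 [_ uniq1]] := phi_min q1 q1P; have [t2 [_ uniq2]] := phi_min q2 q2P.
case/eqP: ne12; rewrite -(uniq1 s1) // -(uniq2 s2) // (uniq1 s0) ?(uniq2 s0) //.
  by move=> s; rewrite -e2.
by move=> s; rewrite -e1.
Qed.

(** * Document matrices realizing both minimizers *)

Section Comparators.
Variables (R : realType) (m d : nat) (d_gt1 : (1 < d)%N) (U : R).
Variables s1 s2 : 'cV[R]_m.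

Definition two_point_documents : 'M[R]_(m, d) :=
  \matrix_(i, j) (if j == 0%N :> nat then s1 i 0 / U
                  else if j == 1%N :> nat then s2 i 0 / U else 0).

Definition axis_weight (j : 'I_d) : 'cV[R]_d := U *: delta_mx j 0.

Lemma norm2_axis_weight j : 0 < U -> norm2 (axis_weight j) <= U.
Proof.
move=> U_gt0; rewrite /norm2 (bigD1 j) //= big_ord1 big1 ?addr0 => [|i ne_i].
  by rewrite !mxE !eqxx mulr1 sqrtr_sqr gtr0_norm.
by rewrite big_ord1 !mxE (negPf ne_i) mulr0 expr0n.
Qed.

Lemma mul_axis_weight j :
  two_point_documents *m axis_weight j = U *: col j two_point_documents.
Proof. by rewrite -scalemxAr -colE. Qed.

Lemma two_point_realizable : 0 < U ->
  exists w1 w2 : 'cV[R]_d,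
    [/\ norm2 w1 <= U, norm2 w2 <= U,
        two_point_documents *m w1 = s1 & two_point_documents *m w2 = s2].
Proof.
move=> U_gt0; have U_neq0 := lt0r_neq0 U_gt0.
exists (axis_weight (Ordinal (ltnW d_gt1))), (axis_weight (Ordinal d_gt1)).
split; rewrite ?norm2_axis_weight // mul_axis_weight;
  by apply/matrixP => i j; rewrite !mxE /= [j]ord1 mulrC divfK.
Qed.

End Comparators.

(** * Linear regret by averaging over adversaries *)

(** The infimum lies below the loss of every admissible weight, so small regret bounds the expected
    loss by that of any chosen comparator. *)
Lemma expectation_le_of_regret_lt (R : realType) (m n d : nat)
    (m_gt0 : (0 < m)%N) (disp : measure_display) (Omega : measurableType disp)
    (phi : surrogate R m n) (argsort : 'cV[R]_m -> 'S_m)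
    (A : learner R m n d Omega) (X : nat -> 'M[R]_(m, d))
    (rel : nat -> relvec m n) (P : probability Omega R) (U c : R) (T : nat)
    (v : 'cV[R]_d) : norm2 v <= U ->
  (expected_regret m_gt0 phi argsort A X rel P U T < c%:E)%E ->
  ('E_P[fun w => (\sum_(0 <= t < T)
                   phi (played m_gt0 argsort A X rel w t) (rel t))%R] <=
   (c + \sum_(0 <= t < T) phi (X t *m v) (rel t))%R%:E)%E.
Proof.
move=> le_v regret_lt; rewrite EFinD -leeBlDr //; apply: ltW.
apply: le_lt_trans regret_lt; apply: leeD2l; rewrite leeN2.
by apply: ereal_inf_lbound; exists v.
Qed.

Theorem theorem21 (R : realType) (m n d : nat)
    (m_gt1 : (1 < m)%N) (n_gt0 : (0 < n)%N)
    (mn_neq : (m, n) <> (2%N, 1%N)) (d_gt1 : (1 < d)%N)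
    (U : R) (U_gt0 : 0 < U)
    (argsort : 'cV[R]_m -> 'S_m) (argsortP : is_argsort argsort)
    (phi : surrogate R m n) (phi_borel : borel_surrogate phi)
    (phi_min : unique_risk_minimizers phi) (phi_cal : ndcg_calibrated phi) :
  exists B : R,
    forall (disp : measure_display) (Omega : measurableType disp)
      (P : probability Omega R) (A : nat -> learner R m n d Omega),
    exists (X : nat -> nat -> 'M[R]_(m, d)) (rel : nat -> nat -> relvec m n),
      (forall (T t : nat) (i : 'I_m), norm2 (row i (X T t)) <= B) /\
      (exists2 c : R, 0 < c &
         \forall T \near \oo,
           ((c * T%:R)%:E <=
            expected_regret (ltnW m_gt1) phi argsort (A T) (X T) (rel T) P U T)%E).
Proof.
have [k [rho1 [rho2 [i [j [marg lt1 lt2]]]]]] :=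
  confusable_samples R m_gt1 n_gt0 mn_neq.
have [s1 [min1 _]] := phi_min _ (sample_law_distribution R rho1).
have [s2 [min2 _]] := phi_min _ (sample_law_distribution R rho2).
have ne12 : s1 != s2.
  have lt_s1 := normalized_gain_separates phi_cal min1 lt1.
  have lt_s2 := normalized_gain_separates phi_cal min2 lt2.
  by apply: contraTneq lt_s1 => ->; rewrite -leNgt ltW.
have [v gap le_v] := minimal_risk_gap phi_min (sample_law_distribution R rho1)
  (sample_law_distribution R rho2) min1 min2 ne12.
set v1 := risk phi s1 _ in gap; set v2 := risk phi s2 _ in gap.
have sumK (rho : 'I_k.+1 -> relvec m n) s :
    \sum_l phi s (rho l) = k.+1%:R * risk phi s (sample_law R rho).
  by rewrite risk_sample_law mulVKf ?pnatr_eq0.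
have [w1 [w2 [w1U w2U Xw1 Xw2]]] := two_point_realizable d_gt1 s1 s2 U_gt0.
set X := two_point_documents d U s1 s2 in Xw1 Xw2.
(* One matrix serves all rounds and horizons, so this bound is fixed before the learner is given. *)
exists (\sum_i norm2 (row i X)) => disp Omega P A.
(* The two laws share the gap, which gives one factor 2; the other makes the final contradiction
   strict. *)
pose c := (v - (v1 + v2)) / 4.
have c_gt0 : 0 < c by rewrite divr_gt0 // subr_gt0.
suff /choice[rel relP] : forall T, exists rel : nat -> relvec m n, (0 < T)%N ->
    ((c * T%:R)%:E <=
     expected_regret (ltnW m_gt1) phi argsort (A T) (fun=> X) rel P U T)%E.
  exists (fun _ _ => X), rel; split=> [T t i'|].
    rewrite (bigD1 i') //= lerDl sumr_ge0 // => ? _; exact: sqrtr_ge0.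
  exists c => //; near=> T; apply: relP; near: T; exact: nbhs_infty_gt.
(* If every relevance sequence had regret below [c * T], then so would all words under both laws,
   and their average would violate the gap. *)
move=> T; apply: contrapT => /forallNP no_rel.
have {no_rel} [T_gt0 regret_lt] : (0 < T)%N /\ forall rel : nat -> relvec m n,
    (expected_regret (ltnW m_gt1) phi argsort (A T) (fun=> X) rel P U T
     < (c * T%:R)%:E)%E.
  split=> [|rel]; first by have /not_implyP[] := no_rel (fun=> [ffun=> ord0]).
  by have /not_implyP[_ /negP] := no_rel rel; rewrite -ltNge.
have [C leC] := choice (fun r => surrogate_lower_bound r phi_min).
pose rho (b : bool) := if b then rho1 else rho2.
pose opt b := if b then s1 else s2.
(* Pairing law and word lets one use of the averaging bound cover both laws. *)
pose index := [seq (b, s) | b <- [:: true; false], s <- words k T].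
have sum_index (F : bool * seq 'I_k.+1 -> R) : \sum_(bs <- index) F bs =
    \sum_(s <- words k T) F (true, s) + \sum_(s <- words k T) F (false, s).
  by rewrite big_allpairs_dep /= !big_cons big_nil addr0.
have le_sum := @le_sum_expectation_bounds _ _ _ P _ index
  (fun bs w => loss (ltnW m_gt1) phi argsort (A T) (fun=> X) (rho bs.1) T bs.2 w)
  (fun bs => \sum_(0 <= t < T) C (word_rel (rho bs.1) bs.2 t))
  (fun bs => c * T%:R
     + \sum_(0 <= t < T) phi (opt bs.1) (word_rel (rho bs.1) bs.2 t))
  ((size (words k T))%:R * (T%:R * v)).
have : (size (words k T))%:R * (T%:R * v) <=
    (size (words k T))%:R * (T%:R * v1 + T%:R * v2 + c * T%:R *+ 2).
  apply: le_trans (le_sum _ _ _ _) _.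
  - move=> [b s]; apply: measurable_sum => t.
    exact: measurable_played_loss.
  - by move=> [b s] w; apply: ler_sum => t _; exact: leC.
  - move=> [b s] /=; have [wb [wbU Xwb]] : exists wb : 'cV[R]_d,
        norm2 wb <= U /\ X *m wb = opt b by case: b; [exists w1|exists w2].
    rewrite -Xwb; apply: expectation_le_of_regret_lt wbU _; exact: regret_lt.
  - move=> w; rewrite sum_index.
    by apply: total_loss_ge => // s; rewrite !sumK -mulrDr ler_pM2l.
  rewrite sum_index !big_split /=.
  rewrite !sum_const_seq.
  (* Averaged over words, each law's comparator pays its minimal risk [v1] or [v2] per round. *)
  rewrite (sum_words_letters T (sumK rho1 s1)) (sum_words_letters T (sumK rho2 s2)).
  rewrite -/v1 -/v2; lra.
rewrite ler_pM2l ?ltr0n ?size_words_gt0 //; apply/negP; rewrite -ltNge.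
have -> : T%:R * v1 + T%:R * v2 + c * T%:R *+ 2 = T%:R * (v1 + v2 + c *+ 2).
  ring.
rewrite ltr_pM2l ?ltr0n // /c; lra.
Unshelve. all: by end_near.
Qed.
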